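(* Let $L_0\in\mathbb{N}$ be an arbitrary fixed number. For every $l=1,\dots,L_0$ (with associated disconnected set $\Delta(2l;T,U)=\bigcup_{k=0}^{2l}[\varphi_1^k(T),\varphi_1^k(T+U)]$) and every $U\in\left(0,\frac{T}{\ln^2T}\right]$, the asymptotic transformation formula $$\int_{\varphi_1^l(T)}^{\varphi_1^l(T+U)}\prod_{k=0}^{l-1}\left|\zeta\left(\tfrac12+i\varphi_1^k(u)\right)\right|^2du\ \sim\ \frac{\varphi_1^{2l}(T+U)-\varphi_1^{2l}(T)}{\varphi_1^{l}(T+U)-\varphi_1^{l}(T)}\int_T^{T+U}\prod_{k=0}^{l-1}\left|\zeta\left(\tfrac12+i\varphi_1^k(t)\right)\right|^2dt,\qquad T\to\infty,$$ holds true.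
   Context: $\zeta$ is the Riemann zeta-function and $Z(t)$ is Hardy's function (real-valued, $|Z(t)|=|\zeta(\frac12+it)|$). Jacob's ladder: fix an admissible function $\mu\in C^\infty([y_0,\infty))$, increasing, unbounded, with $\mu(y)\ge 7y\ln y$. The function $\varphi(T)$ is the solution, for $T$ large, of $$\int_0^{\mu[\varphi(T)]}Z^2(t)e^{-\frac{2}{\varphi(T)}t}\,dt=\int_0^TZ^2(t)\,dt,$$ and the Jacob's ladder is $\varphi_1(t)=\frac12\varphi(t)$, $t\ge T_0[\varphi_1]$. It is continuous and strictly increasing. Iterates: $\varphi_1^0(t)=t$, $\varphi_1^1(t)=\varphi_1(t)$, $\varphi_1^k(t)=\varphi_1[\varphi_1^{k-1}(t)]$ (so superscripts denote iteration, not powers). Standing known properties of $\varphi_1$, for fixed $L_0$, $1\le l\le L_0$ and $U\in(0,T/\ln^2T]$, as $T\to\infty$: $\varphi_1^k(t)\sim t$ for $0\le k\le 2l$; the segments $[\varphi_1^k(T),\varphi_1^k(T+U)]$, $0\le k\le 2l$, are pairwise disjoint and ordered from right to left as $k$ increases; and $$\frac{d\varphi_1(t)}{dt}=\frac{\left|\zeta\left(\frac12+it\right)\right|^2}{\left\{1+O\left(\frac{\ln\ln T}{\ln T}\right)\right\}\ln t},\qquad t\in[\varphi_1^{2l}(T),T+U].$$ Here $U=U(T)$ may be any function of $T$ with values in the stated range, and $A\sim B$ as $T\to\infty$ means $A/B\to1$. *)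

(* Defs.v *)
From Stdlib Require Import Reals.
From Coquelicot Require Import Coquelicot.
Open Scope R_scope.

Definition Cexp (s : C) : C :=
  (exp (Re s) * cos (Im s), exp (Re s) * sin (Im s)).

(** [x ^ s] for real [x > 0]. *)
Definition Cpower (x : R) (s : C) : C := Cexp (Cmult s (RtoC (ln x))).

(** The Riemann zeta-function is the analytic continuation of its Dirichlet
    series to [C \ {1}]; by the identity theorem this determines [zeta] off 1. *)
Definition is_riemann_zeta (zeta : C -> C) : Prop :=
  (forall s : C, 1 < Re s ->
     is_series (K := C_AbsRing) (V := C_NormedModule)
       (fun n : nat => Cpower (INR (S n)) (Copp s)) (zeta s)) /\
  (forall s : C, s <> RtoC 1 ->
     ex_derive (K := C_AbsRing) (V := C_NormedModule) zeta s).

Definition zeta_critical (zeta : C -> C) (t : R) : C := zeta (1 / 2, t).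

Definition zeta_abs2 (zeta : C -> C) (t : R) : R :=
  (Cmod (zeta_critical zeta t)) ^ 2.

(** Euler's integral, convergent for [Re s > 0]. *)
Definition Gamma (s : C) : C :=
  let f x := Cmult (Cpower x (Cminus s (RtoC 1))) (RtoC (exp (- x))) in
  (RInt_gen (fun x => Re (f x)) (at_right 0) (Rbar_locally p_infty),
   RInt_gen (fun x => Im (f x)) (at_right 0) (Rbar_locally p_infty)).

(** [exp (i theta(t))] for the Riemann-Siegel theta function
    [theta(t) = - t/2 ln pi + Im (ln Gamma (1/4 + i t/2))]; writing
    [exp (i Im (ln g))] as [g / |g|] avoids choosing a branch of [ln Gamma]. *)
Definition theta_phase (t : R) : C :=
  let g := Gamma (1 / 4, t / 2) in
  Cmult (Cexp (0, - (t / 2) * ln PI)) (Cdiv g (RtoC (Cmod g))).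

(** Hardy's function [Z(t) = exp (i theta(t)) zeta(1/2 + i t)]. The product is
    real by the functional equation, so [Re] only adjusts the type. *)
Definition hardyZ (zeta : C -> C) (t : R) : R :=
  Re (Cmult (theta_phase t) (zeta_critical zeta t)).

(** [C^infinity] on a set [D], with derivatives taken within [D] (one-sided at
    the endpoint of a half-line); [d n] is the [n]-th derivative. *)
Definition smooth_on (D : R -> Prop) (f : R -> R) : Prop :=
  exists d : nat -> R -> R,
    (forall x, D x -> d 0%nat x = f x) /\
    (forall n x, D x -> D_in (d n) (d (S n)) D x).

Definition admissible_mu (y0 : R) (mu : R -> R) : Prop :=
  0 < y0 /\
  smooth_on (fun y => y0 <= y) mu /\
  (forall y1 y2, y0 <= y1 -> y1 <= y2 -> mu y1 <= mu y2) /\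
  (forall M, exists y, y0 <= y /\ M < mu y) /\
  (forall y, y0 <= y -> 7 * y * ln y <= mu y).

(** [phi T] solves the defining equation for [T >= T0]. The left-hand side
    below is strictly increasing as a function of [phi T] where [mu > 0], so for
    [T > 0] the solution is unique. *)
Definition solves_ladder_equation (zeta : C -> C) (y0 : R) (mu : R -> R)
    (T0 : R) (phi : R -> R) : Prop :=
  forall T, T0 <= T ->
    y0 <= phi T /\
    RInt (fun t => (hardyZ zeta t) ^ 2 * exp (- (2 / phi T) * t))
         0 (mu (phi T))
    = RInt (fun t => (hardyZ zeta t) ^ 2) 0 T.

Definition jacob_ladder (phi : R -> R) (t : R) : R := 1 / 2 * phi t.

(** [f ~ g] at [+oo]. *)
Definition asymp (f g : R -> R) : Prop := is_lim (fun T => f T / g T) p_infty 1.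

Definition admissible_length (U : R -> R) : Prop :=
  Rbar_locally p_infty (fun T => 0 < U T <= T / (ln T) ^ 2).

Definition iterate (phi1 : R -> R) (k : nat) (t : R) : R := Nat.iter k phi1 t.

Definition ladder_segment (phi1 U : R -> R) (k : nat) (T x : R) : Prop :=
  iterate phi1 k T <= x <= iterate phi1 k (T + U T).

(** The standing properties of the ladder. The last clause reads
    [phi1' (t) = |zeta(1/2 + i t)|^2 / ({1 + O(ln ln T / ln T)} ln t)], the
    [O]-term [r] being uniform in [t]. *)
Definition ladder_properties (zeta : C -> C) (T0 : R) (phi1 : R -> R)
    (L0 : nat) : Prop :=
  continuous_on (fun t => T0 <= t) phi1 /\
  (forall t1 t2, T0 <= t1 -> t1 < t2 -> phi1 t1 < phi1 t2) /\
  forall l : nat, (1 <= l <= L0)%nat ->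
  forall U : R -> R, admissible_length U ->
    (forall k : nat, (k <= 2 * l)%nat -> asymp (iterate phi1 k) (fun t => t)) /\
    Rbar_locally p_infty (fun T =>
      forall j k : nat, (j < k <= 2 * l)%nat ->
      forall x y, ladder_segment phi1 U k T x -> ladder_segment phi1 U j T y ->
        x < y) /\
    (exists K : R, Rbar_locally p_infty (fun T =>
      forall t, iterate phi1 (2 * l) T <= t <= T + U T ->
      exists r : R, Rabs r <= K * (ln (ln T) / ln T) /\
        is_derive phi1 t (zeta_abs2 zeta t / ((1 + r) * ln t)))).

(** [prod_{k=0}^{l-1} |zeta(1/2 + i phi1^k(u))|^2] for [l >= 1]
    ([prod_f_R0 f n] has [n + 1] factors). *)
Definition zeta_product (zeta : C -> C) (phi1 : R -> R) (l : nat) (u : R) : R :=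
  prod_f_R0 (fun k => zeta_abs2 zeta (iterate phi1 k u)) (l - 1).

(* Main.v *)
Require Import Defs.
From Stdlib Require Import Reals Lra Lia.
From Coquelicot Require Import Coquelicot.
Open Scope R_scope.

(** By the chain rule, [phi1^l] has derivative at [t] the product over [k < l]
    of [phi1' (phi1^k (t))], and the formula for [phi1'] turns this into the
    product of the [|zeta(1/2 + i phi1^k(t))|^2] divided by the product of the
    [(1 + o(1)) ln (phi1^k (t))].  All the points [phi1^k (t)] are comparable
    with [T], so every logarithm is [(1 + o(1)) ln T].  Hence, uniformly,
    the zeta product equals [(1 + o(1)) (ln T)^l (phi1^l)'], and integration
    over a segment [[x, y]] gives
    [(1 + o(1)) (ln T)^l (phi1^l (y) - phi1^l (x))]
    ([RInt_iterate_product_bounds]).  This applies both to [[T, T + U]] and to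
    [[phi1^l (T), phi1^l (T + U)]], whose image under [phi1^l] has endpoints
    [phi1^(2l) (T)] and [phi1^(2l) (T + U)]; in the quotient of the two
    integrals [(ln T)^l] cancels, which is the claim.

    The asymptotic relations are handled as two-sided inequalities with
    constants [(1 - eta) ln T] and [(1 + eta) ln T] in place of [ln T], valid
    for large [T]; [derive_bounds_of_error] provides them for one factor, and
    [iterate_mem_hull] ensures that all iterates that occur stay in the range
    where the formula for [phi1'] holds. *)

(** * Continuity of the zeta factor *)

Lemma zeta_abs2_continuous (zeta : C -> C) (hzeta : is_riemann_zeta zeta) (t : R) :
  continuous (zeta_abs2 zeta) t.
Proof.
  assert (hline : filterlim (fun u : R => (1 / 2, u) : C_AbsRing) (locally t)
                    (locally ((1 / 2, t) : C_AbsRing))).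
  { (* The line is an isometry for the modulus, which is the metric of the
       domain in which zeta is differentiable. *)
    apply filterlim_locally. intros eps. exists eps. intros u hu.
    change (Cmod (1 / 2 + - (1 / 2), u + - t) < eps).
    replace (1 / 2 + - (1 / 2)) with 0 by lra.
    unfold Cmod; cbn [fst snd].
    replace (0 ^ 2 + (u + - t) ^ 2) with (Rsqr (u - t)) by (unfold Rsqr; ring).
    rewrite sqrt_Rsqr_abs. exact hu. }
  assert (hz : filterlim zeta (locally ((1 / 2, t) : C_AbsRing))
                 (locally (zeta (1 / 2, t) : C_NormedModule))).
  { apply (ex_derive_continuous (K := C_AbsRing) (V := C_NormedModule)).
    apply (proj2 hzeta). intros h. injection h. lra. }
  assert (hmod : continuous (fun u => Cmod (zeta (1 / 2, u))) t).
  { apply (filterlim_comp _ _ _ (fun u => zeta (1 / 2, u)) Cmod _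
             (locally (zeta (1 / 2, t) : C_NormedModule))).
    - exact (filterlim_comp _ _ _ _ _ _ _ _ hline hz).
    - exact (filterlim_norm (V := C_NormedModule) (zeta (1 / 2, t))). }
  apply (continuous_ext (fun u => Cmod (zeta (1 / 2, u)) * Cmod (zeta (1 / 2, u)))).
  { intros u. unfold zeta_abs2, zeta_critical. simpl. ring. }
  apply (continuous_mult (K := R_AbsRing)); exact hmod.
Qed.

(** * Integrals compared with increments of a primitive *)

(** Mean value theorem for [RInt f a x - c * F x], whose derivative is
    nonnegative.  Integrating the derivative of [F] instead is not possible: the
    error term in the formula for [phi1'] is only known to be bounded, so that
    this derivative is not known to be Riemann integrable. *)
Lemma le_RInt_of_derive_le (f F : R -> R) (a b c : R) (hab : a <= b)
  (hf : forall x, a <= x <= b -> continuous f x)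
  (hF : forall x, a <= x <= b -> exists d, is_derive F x d /\ c * d <= f x) :
  c * (F b - F a) <= RInt f a b.
Proof.
  (* Replacing [f] by a continuous extension makes the integral two-sidedly
     differentiable at the endpoints too. *)
  destruct (C0_extension_le f a b hf) as [g [hg hgf]].
  rewrite <- (RInt_ext g f a b).
  2: { intros x. rewrite Rmin_left, Rmax_right by lra. intros hx. apply hgf. lra. }
  assert (hI : forall u v, ex_RInt g u v).
  { intros u v. apply (ex_RInt_continuous (V := R_CompleteNormedModule)).
    intros z _. apply hg. }
  assert (hG : forall x, is_derive (fun y => RInt g a y) x (g x)).
  { intros x. apply (is_derive_RInt (V := R_NormedModule) g _ a).
    - apply filter_forall. intros y.
      apply (RInt_correct (V := R_CompleteNormedModule)), hI.
    - apply hg. }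
  assert (hd : forall x, a <= x <= b ->
    is_derive (fun y => RInt g a y - c * F y) x (g x - c * Derive F x)).
  { intros x hx. destruct (hF x hx) as [d [hd _]].
    apply (is_derive_minus (V := R_NormedModule)); [apply hG|].
    apply is_derive_scal, Derive_correct. exists d. exact hd. }
  destruct (MVT_gen (fun y => RInt g a y - c * F y) a b
              (fun x => g x - c * Derive F x)) as [x [hx hmv]];
    rewrite Rmin_left, Rmax_right in * by lra.
  - intros x hx. apply hd. lra.
  - intros x hx. apply continuity_pt_filterlim.
    apply (ex_derive_continuous (V := R_NormedModule)
             (fun y => RInt g a y - c * F y)).
    eexists. apply hd. exact hx.
  - destruct (hF x hx) as [d [hdx hle]].
    rewrite (is_derive_unique _ _ _ hdx), hgf in hmv by exact hx.
    rewrite RInt_point in hmv. change (@zero _) with 0 in hmv.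
    assert (0 <= (f x - c * d) * (b - a)) by (apply Rmult_le_pos; lra).
    lra.
Qed.

Lemma RInt_bounds_of_derive_bounds (f F : R -> R) (a b A B : R) (hab : a <= b)
  (hf : forall x, a <= x <= b -> continuous f x)
  (hF : forall x, a <= x <= b ->
     exists d, is_derive F x d /\ A * d <= f x <= B * d) :
  A * (F b - F a) <= RInt f a b <= B * (F b - F a).
Proof.
  split.
  - apply le_RInt_of_derive_le; [exact hab | exact hf |].
    intros x hx. destruct (hF x hx) as [d [hd hle]]. exists d. tauto.
  - assert (h : - B * (F b - F a) <= RInt (fun x => - f x) a b).
    { apply le_RInt_of_derive_le; [exact hab | |].
      - intros x hx. apply (continuous_opp (V := R_NormedModule) f), hf, hx.
      - intros x hx. destruct (hF x hx) as [d [hd hle]]. exists d.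
        split; [exact hd | lra]. }
    assert (hopp : RInt (fun x => - f x) a b = - RInt f a b).
    { apply (RInt_opp (V := R_CompleteNormedModule) f a b).
      apply (ex_RInt_continuous (V := R_CompleteNormedModule)).
      intros x. rewrite Rmin_left, Rmax_right by lra. apply hf. }
    lra.
Qed.

(** * Iterates of a function *)

(** Chain rule: the derivative of the iterate is the product of the derivatives
    along the orbit, and the sandwiches between [d], [a] and [b] at the single
    points of the orbit multiply because everything is nonnegative. *)
Lemma iterate_derive_bounds (phi1 w : R -> R) (a b t : R) (m : nat)
  (ha : 0 <= a) (hw : forall x, 0 <= w x)
  (hstep : forall k, (k <= m)%nat -> exists d,
     is_derive phi1 (iterate phi1 k t) d /\
     0 <= d /\ a * d <= w (iterate phi1 k t) <= b * d) :
  exists d, is_derive (iterate phi1 (S m)) t d /\ 0 <= d /\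
    a ^ S m * d <= prod_f_R0 (fun k => w (iterate phi1 k t)) m <= b ^ S m * d.
Proof.
  induction m as [|m IH].
  - destruct (hstep 0%nat (le_n 0)) as [d hd].
    exists d. rewrite !pow_1. exact hd.
  - destruct IH as [d [hd [hd0 hle]]]; [intros k hk; apply hstep; lia|].
    destruct (hstep (S m) (le_n _)) as [e [he [he0 hle']]].
    exists (d * e). split; [|split].
    + exact (is_derive_comp (V := R_NormedModule) phi1 (iterate phi1 (S m)) t e d he hd).
    + apply Rmult_le_pos; assumption.
    + change (prod_f_R0 (fun k => w (iterate phi1 k t)) (S m))
        with (prod_f_R0 (fun k => w (iterate phi1 k t)) m * w (iterate phi1 (S m) t)).
      replace (a ^ S (S m) * (d * e)) with (a ^ S m * d * (a * e)) by (simpl; ring).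
      replace (b ^ S (S m) * (d * e)) with (b ^ S m * d * (b * e)) by (simpl; ring).
      assert (0 <= a ^ S m * d).
      { apply Rmult_le_pos; [apply pow_le|]; assumption. }
      assert (0 <= a * e) by (apply Rmult_le_pos; assumption).
      split; apply Rmult_le_compat; try lra; apply hw.
Qed.

Lemma iterate_continuous (phi1 : R -> R) (t : R) (m : nat) :
  (forall k, (k < m)%nat -> continuous phi1 (iterate phi1 k t)) ->
  continuous (iterate phi1 m) t.
Proof.
  induction m as [|m IH]; intros h.
  - apply continuous_id.
  - apply (continuous_comp (iterate phi1 m) phi1).
    + apply IH. intros k hk. apply h. lia.
    + apply h. lia.
Qed.

Lemma prod_f_R0_continuous (f : nat -> R -> R) (t : R) (m : nat) :
  (forall k, (k <= m)%nat -> continuous (f k) t) ->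
  continuous (fun u => prod_f_R0 (fun k => f k u) m) t.
Proof.
  induction m as [|m IH]; intros h.
  - apply h. lia.
  - apply (continuous_mult (K := R_AbsRing)
             (fun u => prod_f_R0 (fun k => f k u) m) (f (S m))).
    + apply IH. intros k hk. apply h. lia.
    + apply h. lia.
Qed.

(** Monotonicity is known only on the half-line from [T0]; the comparison with
    the orbit of [T] keeps every iterate there. *)
Lemma iterate_increasing (phi1 : R -> R) (T0 : R)
  (hinc : forall t1 t2, T0 <= t1 -> t1 < t2 -> phi1 t1 < phi1 t2)
  (T : R) (n : nat) (hT : forall k, (k <= n)%nat -> T0 <= iterate phi1 k T)
  (k : nat) (hk : (k <= n)%nat) (x y : R) (hTx : T <= x) (hxy : x < y) :
  iterate phi1 k T <= iterate phi1 k x < iterate phi1 k y.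
Proof.
  induction k as [|k IH].
  - simpl. lra.
  - destruct IH as [h1 h2]; [lia|].
    assert (h0 : T0 <= iterate phi1 k T) by (apply hT; lia).
    change (phi1 (iterate phi1 k T) <= phi1 (iterate phi1 k x)
            < phi1 (iterate phi1 k y)).
    split; [|apply hinc; lra].
    destruct (Rle_lt_or_eq_dec _ _ h1) as [h|h].
    + left. apply hinc; lra.
    + rewrite h. right. reflexivity.
Qed.

Lemma iterate_add (phi1 : R -> R) (j k : nat) (t : R) :
  iterate phi1 (k + j) t = iterate phi1 k (iterate phi1 j t).
Proof.
  induction k as [|k IH]; [reflexivity|].
  change (phi1 (iterate phi1 (k + j) t) = phi1 (iterate phi1 k (iterate phi1 j t))).
  now rewrite IH.
Qed.

(** * Estimates for large T *)

Lemma eventually_forall_le (P : nat -> R -> Prop) (n : nat) :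
  (forall k, (k <= n)%nat -> Rbar_locally p_infty (P k)) ->
  Rbar_locally p_infty (fun T => forall k, (k <= n)%nat -> P k T).
Proof.
  induction n as [|n IH]; intros h.
  - apply (filter_imp (P 0%nat)); [|apply h; lia].
    intros T hT k hk. now replace k with 0%nat by lia.
  - apply (filter_imp (fun T => (forall k, (k <= n)%nat -> P k T) /\ P (S n) T)).
    + intros T [h1 h2] k hk. destruct (Nat.eq_dec k (S n)) as [->|hne]; [exact h2|].
      apply h1. lia.
    + apply filter_and; [apply IH; intros k hk; apply h; lia | apply h; lia].
Qed.

Lemma asymp_id_ge_half (f : R -> R) (hf : asymp f (fun t => t)) :
  Rbar_locally p_infty (fun T => T / 2 <= f T).
Proof.
  apply is_lim_spec in hf.
  assert (h2 : 0 < 1 / 2) by lra.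
  destruct (hf (mkposreal _ h2)) as [M hM]. simpl in hM.
  exists (Rmax M 0). intros T hT.
  assert (M < T) by (eapply Rle_lt_trans; [apply Rmax_l | exact hT]).
  assert (0 < T) by (eapply Rle_lt_trans; [apply Rmax_r | exact hT]).
  assert (hq := hM T ltac:(assumption)). apply Rabs_def2 in hq.
  replace (f T) with (f T / T * T) by (field; lra).
  replace (T / 2) with (1 / 2 * T) by field.
  apply Rmult_le_compat_r; lra.
Qed.

Lemma eventually_small_error (K eta : R) (heta : 0 < eta) :
  Rbar_locally p_infty (fun T => K * (ln (ln T) / ln T) < eta).
Proof.
  assert (h : is_lim (fun T => K * (ln (ln T) / ln T)) p_infty 0).
  { replace (Finite 0) with (Rbar_mult K 0) by (simpl; f_equal; ring).
    apply is_lim_scal_l.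
    apply (is_lim_comp (fun y => ln y / y) ln p_infty 0 p_infty).
    - apply is_lim_div_ln_p.
    - apply is_lim_ln_p.
    - exists 0. intros y _. discriminate. }
  apply is_lim_spec in h.
  destruct (h (mkposreal eta heta)) as [M hM]. simpl in hM.
  exists M. intros T hT. specialize (hM T hT). apply Rabs_def2 in hM. lra.
Qed.

Lemma eventually_ln_ge (M : R) : Rbar_locally p_infty (fun T => M <= ln T).
Proof.
  exists (exp M). intros T hT. rewrite <- (ln_exp M). left.
  apply ln_increasing; [apply exp_pos | exact hT].
Qed.

(** Both sources of error are of relative size at most [eta / 3]: the term [r]
    by assumption, and [ln t] because it differs from [ln T] by at most
    [ln 2 < 1], while [eta / 3 * ln T >= 1]. *)
Lemma derive_bounds_of_error (phi1 w : R -> R) (T t r eta : R)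
  (hT : 0 < T) (heta : 0 < eta <= 1) (hln : 3 / eta <= ln T)
  (ht : T / 2 <= t <= 2 * T) (hr : Rabs r <= eta / 3) (hw : 0 <= w t)
  (hd : is_derive phi1 t (w t / ((1 + r) * ln t))) :
  exists d, is_derive phi1 t d /\ 0 <= d /\
    (1 - eta) * ln T * d <= w t <= (1 + eta) * ln T * d.
Proof.
  set (L := ln T) in *.
  assert (hL : 3 <= eta * L).
  { replace 3 with (eta * (3 / eta)) by (field; lra). apply Rmult_le_compat_l; lra. }
  assert (h2 : ln 2 < 1).
  { rewrite <- (ln_exp 1). apply ln_increasing; [lra|].
    pose proof (exp_ineq1 1). lra. }
  assert (hlt : L - 1 <= ln t <= L + 1).
  { split.
    - apply Rle_trans with (ln (T / 2)); [|apply ln_le; lra].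
      unfold Rdiv. rewrite ln_mult, ln_Rinv by lra. unfold L. lra.
    - apply Rle_trans with (ln (2 * T)); [apply ln_le; lra|].
      rewrite ln_mult by lra. unfold L. lra. }
  apply Rabs_le_between in hr.
  assert (hL3 : 3 <= L) by nra.
  set (q := (1 + r) * ln t) in *.
  assert (hq : 0 < q) by (apply Rmult_lt_0_compat; lra).
  assert (hq' : (1 - eta) * L <= q <= (1 + eta) * L).
  { split.
    - apply Rle_trans with ((1 - eta / 3) * (L - 1)); [nra|].
      apply Rmult_le_compat; lra.
    - apply Rle_trans with ((1 + eta / 3) * (L + 1)); [|nra].
      apply Rmult_le_compat; lra. }
  exists (w t / q). split; [exact hd|].
  assert (h0 : 0 <= w t / q).
  { apply Rmult_le_pos; [exact hw | left; apply Rinv_0_lt_compat, hq]. }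
  split; [exact h0|].
  replace (w t) with (q * (w t / q)) at 2 3 by (field; lra).
  split; apply Rmult_le_compat_r; lra.
Qed.

(** The worst ratio of the upper to the lower constant over [l] factors is
    continuous in [eta] and equal to 1 at [eta = 0]. *)
Lemma exists_pow_ratio_bound (l : nat) (eps : R) (heps : 0 < eps) :
  exists eta, 0 < eta < 1 /\ ((1 + eta) / (1 - eta)) ^ l < 1 + eps.
Proof.
  set (h := fun x : R => ((1 + x) / (1 - x)) ^ l).
  assert (hc : continuous h 0).
  { apply (ex_derive_continuous (V := R_NormedModule)). unfold h.
    auto_derive. lra. }
  destruct (proj1 (filterlim_locally _ _) hc (mkposreal eps heps)) as [d hd].
  simpl in hd.
  assert (hd0 := cond_pos d).
  set (eta := Rmin (d / 2) (1 / 2)).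
  assert (he : 0 < eta) by (apply Rmin_glb_lt; lra).
  assert (he1 : eta <= d / 2) by apply Rmin_l.
  assert (he2 : eta <= 1 / 2) by apply Rmin_r.
  exists eta. split; [lra|].
  assert (hb : ball 0 d eta).
  { change (Rabs (eta - 0) < d). rewrite Rabs_pos_eq; lra. }
  specialize (hd eta hb). change (Rabs (h eta - h 0) < eps) in hd.
  apply Rabs_def2 in hd.
  assert (h 0 = 1).
  { unfold h. replace ((1 + 0) / (1 - 0)) with 1 by field. apply pow1. }
  fold (h eta). lra.
Qed.

(** The quotient is [(I' / D') / (I / D)] with both terms in [[A, B]], so it lies
    between [A / B] and [B / A]; and [A / B > 1 / (1 + eps) > 1 - eps]. *)
Lemma ratio_near_one (A B D D' I I' eps : R)
  (hA : 0 < A) (hB : B / A < 1 + eps) (hD : 0 < D) (hD' : 0 < D')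
  (hI : A * D <= I <= B * D) (hI' : A * D' <= I' <= B * D') :
  Rabs (I' / (D' / D * I) - 1) < eps.
Proof.
  assert (0 < A * D) by (apply Rmult_lt_0_compat; assumption).
  assert (0 < A * D') by (apply Rmult_lt_0_compat; assumption).
  set (x := I / D). set (y := I' / D').
  replace (I' / (D' / D * I)) with (y / x)
    by (unfold x, y; field; repeat split; lra).
  assert (hx : A <= x <= B).
  { unfold x. split; [apply Rle_div_r | apply Rle_div_l]; lra. }
  assert (hy : A <= y <= B).
  { unfold y. split; [apply Rle_div_r | apply Rle_div_l]; lra. }
  apply Rlt_div_l in hB; [|lra].
  assert (he : 0 < eps) by nra.
  apply Rabs_def1.
  - apply Rplus_lt_reg_r with 1. replace (y / x - 1 + 1) with (y / x) by ring.
    apply Rlt_div_l; nra.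
  - apply Rplus_lt_reg_r with 1. replace (y / x - 1 + 1) with (y / x) by ring.
    apply Rlt_div_r; [lra|].
    destruct (Rle_lt_dec 1 eps); nra.
Qed.

(** * The transformation formula *)

Lemma RInt_iterate_product_bounds (phi1 w : R -> R) (a b x y : R) (m : nat)
  (ha : 0 <= a) (hw : forall u, 0 <= w u) (hwc : forall u, continuous w u)
  (hxy : x <= y)
  (hstep : forall t, x <= t <= y -> forall k, (k <= m)%nat -> exists d,
     is_derive phi1 (iterate phi1 k t) d /\
     0 <= d /\ a * d <= w (iterate phi1 k t) <= b * d) :
  a ^ S m * (iterate phi1 (S m) y - iterate phi1 (S m) x)
  <= RInt (fun u => prod_f_R0 (fun k => w (iterate phi1 k u)) m) x y
  <= b ^ S m * (iterate phi1 (S m) y - iterate phi1 (S m) x).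
Proof.
  apply RInt_bounds_of_derive_bounds; [exact hxy | |].
  - intros t ht. apply (prod_f_R0_continuous (fun k u => w (iterate phi1 k u))).
    intros k hk. apply (continuous_comp (iterate phi1 k) w); [|apply hwc].
    apply iterate_continuous. intros i hi.
    destruct (hstep t ht i) as [d [hd _]]; [lia|].
    apply (ex_derive_continuous (V := R_NormedModule)). exists d. exact hd.
  - intros t ht.
    destruct (iterate_derive_bounds phi1 w a b t m ha hw (hstep t ht))
      as [d [hd [_ hle]]].
    exists d. split; assumption.
Qed.

(** The point [phi1^k (t)] lies in the segment of index [k + j].  All segments are
    to the right of or equal to the last one, which gives the lower bound, and
    to the left of or equal to the initial one [[T, V]], which gives the upper
    bound. *)
Lemma iterate_mem_hull (phi1 : R -> R) (T0 : R)
  (hinc : forall t1 t2, T0 <= t1 -> t1 < t2 -> phi1 t1 < phi1 t2)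
  (T V : R) (hTV : T < V) (n : nat)
  (hT : forall k, (k <= n)%nat -> T0 <= iterate phi1 k T)
  (hord : forall j k : nat, (j < k <= n)%nat -> forall x y,
     iterate phi1 k T <= x <= iterate phi1 k V ->
     iterate phi1 j T <= y <= iterate phi1 j V -> x < y)
  (j k : nat) (hjk : (k + j <= n)%nat) (t : R)
  (ht : iterate phi1 j T <= t <= iterate phi1 j V) :
  iterate phi1 n T <= iterate phi1 k t <= V.
Proof.
  assert (hseg : forall i, (i <= n)%nat -> iterate phi1 i T < iterate phi1 i V).
  { intros i hi.
    destruct (iterate_increasing phi1 T0 hinc T n hT i hi T V) as [_ h];
      [lra | exact hTV | exact h]. }
  assert (hmono : forall x y, iterate phi1 j T <= x -> x <= y ->
                    iterate phi1 k x <= iterate phi1 k y).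
  { intros x y hx hxy. destruct (Rle_lt_or_eq_dec _ _ hxy) as [h| ->]; [|lra].
    left. apply (iterate_increasing phi1 T0 hinc (iterate phi1 j T) (n - j));
      try assumption; try lia.
    intros i hi. rewrite <- iterate_add. apply hT. lia. }
  assert (hkj := hseg (k + j)%nat hjk).
  split.
  - apply Rle_trans with (iterate phi1 (k + j) T).
    + destruct (Nat.eq_dec (k + j) n) as [->|hne]; [lra|]. left.
      assert (hn := hseg n (le_n n)).
      apply (hord (k + j)%nat n); [lia | lra | lra].
    + rewrite iterate_add. apply hmono; lra.
  - apply Rle_trans with (iterate phi1 (k + j) V).
    + rewrite iterate_add. apply hmono; lra.
    + destruct (Nat.eq_dec (k + j) 0) as [->|hne]; [apply Rle_refl|]. left.
      apply (hord 0%nat (k + j)%nat); [lia | lra |]. simpl. lra.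
Qed.

Theorem mainTheorem1
  (zeta : C -> C) (hzeta : is_riemann_zeta zeta)
  (y0 : R) (mu : R -> R) (hmu : admissible_mu y0 mu)
  (T0 : R) (phi : R -> R) (hphi : solves_ladder_equation zeta y0 mu T0 phi)
  (L0 : nat) (hladder : ladder_properties zeta T0 (jacob_ladder phi) L0) :
  forall l : nat, (1 <= l <= L0)%nat ->
  forall U : R -> R, admissible_length U ->
  let phi1 := jacob_ladder phi in
  asymp
    (fun T => RInt (zeta_product zeta phi1 l)
                   (iterate phi1 l T) (iterate phi1 l (T + U T)))
    (fun T => (iterate phi1 (2 * l) (T + U T) - iterate phi1 (2 * l) T)
              / (iterate phi1 l (T + U T) - iterate phi1 l T)
              * RInt (zeta_product zeta phi1 l) T (T + U T)).
Proof.
  intros l hl U hU phi1.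
  destruct hladder as [_ [hinc hprop]]. fold phi1 in hinc, hprop.
  destruct (hprop l hl U hU) as [hasym [hord [K hder]]]. clear hprop.
  apply is_lim_spec. intros eps.
  (* [eta] is the relative error allowed in each factor so that the final
     quotient is within [eps] of 1. *)
  destruct (exists_pow_ratio_bound l eps (cond_pos eps)) as [eta [heta hratio]].
  assert (hlarge : Rbar_locally p_infty
            (fun T => forall k, (k <= 2 * l)%nat -> T / 2 <= iterate phi1 k T)).
  { apply (eventually_forall_le (fun k T => T / 2 <= iterate phi1 k T)).
    intros k hk. apply asymp_id_ge_half, hasym, hk. }
  assert (herr := eventually_small_error K (eta / 3) ltac:(lra)).
  assert (hlnT := eventually_ln_ge (3 / eta)).
  assert (hpos : Rbar_locally p_infty (fun T => 0 < T)) by (exists 0; auto).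
  assert (hT0 : Rbar_locally p_infty (fun T => 2 * T0 < T)) by (exists (2 * T0); auto).
  change (Rbar_locally p_infty (fun T =>
    Rabs (RInt (zeta_product zeta phi1 l) (iterate phi1 l T) (iterate phi1 l (T + U T)) /
          ((iterate phi1 (2 * l) (T + U T) - iterate phi1 (2 * l) T)
           / (iterate phi1 l (T + U T) - iterate phi1 l T)
           * RInt (zeta_product zeta phi1 l) T (T + U T)) - 1) < eps)).
  generalize (filter_and _ _ hU (filter_and _ _ hord (filter_and _ _ hder
    (filter_and _ _ hlarge (filter_and _ _ herr (filter_and _ _ hlnT
    (filter_and _ _ hpos hT0))))))).
  apply filter_imp. clear hU hord hder hlarge herr hlnT hpos hT0 hasym.
  intros T [[hU0 hU] [hord [hder [hlarge [herr [hlnT [hpos hT0]]]]]]].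
  set (V := T + U T) in *.
  assert (hTV : T < V) by (unfold V; lra).
  assert (hln3 : 3 <= ln T).
  { apply Rle_trans with (3 / eta); [|exact hlnT]. apply Rle_div_r; lra. }
  assert (hV : V <= 2 * T).
  { assert (T / ln T ^ 2 <= T); [|unfold V; lra].
    apply Rle_div_l; [nra|]. rewrite <- (Rmult_1_r T) at 1.
    apply Rmult_le_compat_l; nra. }
  assert (hT0k : forall k, (k <= 2 * l)%nat -> T0 <= iterate phi1 k T).
  { intros k hk. specialize (hlarge k hk). lra. }
  assert (hw : forall u, 0 <= zeta_abs2 zeta u) by (intros u; apply pow2_ge_0).
  assert (hbound : forall t, iterate phi1 (2 * l) T <= t <= V -> exists d,
    is_derive phi1 t d /\ 0 <= d /\
    (1 - eta) * ln T * d <= zeta_abs2 zeta t <= (1 + eta) * ln T * d).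
  { intros t ht. destruct (hder t ht) as [r [hr hd]].
    assert (hlow := hlarge (2 * l)%nat (le_n _)).
    apply (derive_bounds_of_error phi1 (zeta_abs2 zeta) T t r eta); auto; lra. }
  (* Used for [j = 0], the segment from [T], and for [j = l], the segment from
     [phi1^l (T)]. *)
  assert (hint : forall j, (l + j <= 2 * l)%nat ->
    iterate phi1 (l + j) T < iterate phi1 (l + j) V /\
    ((1 - eta) * ln T) ^ l * (iterate phi1 (l + j) V - iterate phi1 (l + j) T)
    <= RInt (zeta_product zeta phi1 l) (iterate phi1 j T) (iterate phi1 j V)
    <= ((1 + eta) * ln T) ^ l * (iterate phi1 (l + j) V - iterate phi1 (l + j) T)).
  { intros j hj.
    assert (hseg : forall i, (i <= 2 * l)%nat -> iterate phi1 i T < iterate phi1 i V).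
    { intros i hi.
      destruct (iterate_increasing phi1 T0 hinc T (2 * l) hT0k i hi T V) as [_ h];
        [lra | exact hTV | exact h]. }
    split; [apply hseg, hj|].
    rewrite !(iterate_add phi1 j l).
    assert (h := RInt_iterate_product_bounds phi1 (zeta_abs2 zeta)
      ((1 - eta) * ln T) ((1 + eta) * ln T)
      (iterate phi1 j T) (iterate phi1 j V) (l - 1)).
    replace (S (l - 1)) with l in h by lia.
    apply h.
    - apply Rmult_le_pos; lra.
    - exact hw.
    - apply zeta_abs2_continuous, hzeta.
    - left. apply hseg. lia.
    - intros t ht k hk. apply hbound.
      apply (iterate_mem_hull phi1 T0 hinc T V hTV (2 * l) hT0k hord j k);
        [lia | exact ht]. }
  destruct (hint 0%nat ltac:(lia)) as [hD hI].
  destruct (hint l ltac:(lia)) as [hD' hI'].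
  rewrite Nat.add_0_r in hD, hI.
  replace (l + l)%nat with (2 * l)%nat in hD', hI' by lia.
  apply (ratio_near_one (((1 - eta) * ln T) ^ l) (((1 + eta) * ln T) ^ l)).
  - apply pow_lt, Rmult_lt_0_compat; lra.
  - rewrite !Rpow_mult_distr.
    replace ((1 + eta) ^ l * ln T ^ l / ((1 - eta) ^ l * ln T ^ l))
      with (((1 + eta) / (1 - eta)) ^ l); [exact hratio|].
    unfold Rdiv. rewrite Rpow_mult_distr, pow_inv. field.
    split; apply pow_nonzero; lra.
  - lra.
  - lra.
  - exact hI.
  - exact hI'.
Qed.
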